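(* Let $\mathrm{U}$ be a countable homogeneous relational structure whose age is a free amalgamation age, with automorphism group $\mathrm{G}$. Then every bundle $\mathcal B=\{\underline B_j:j\in n\}$ ($n\in\omega$) of types of $\mathrm{U}$ is weakly indivisible: for every family $P=(P_{i,j}:i\in 2,\ j\in n)$ such that $(P_{0,j},P_{1,j})$ is a partition of $\sigma(\underline B_j)$ for each $j$, there exist a set $J\subseteq n$, a function $\epsilon':n\to 2$ and a copy $C$ of $\mathcal B$ such that $C\cap\sigma(\underline B_j)\subseteq P_{\epsilon'(j),j}$ for every $j\in J$, and $\overline{\rho}(P_\epsilon\cap C)=\overline{\rho}(\sigma(\mathcal B))$ for every $\epsilon:n\to2$ agreeing with $\epsilon'$ on $J$, where $P_\epsilon=\bigcup_{j\in n}P_{\epsilon(j),j}$.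
   Context: Relational languages have no $0$-ary symbols; relations hold only on tuples of distinct elements. Homogeneous: every isomorphism between finite induced substructures extends to an automorphism. Free amalgamation age: a class of finite structures closed under induced substructures and free amalgams (the union of two structures agreeing on a common part with no relation on a tuple meeting both non-common parts). $\mathrm{G}_F$ is the pointwise stabilizer of $F$. A type is $\langle F\mid x\rangle$ with $F\subseteq U$ finite (its sockel $\iota$) and $x\notin F$; its typeset is $\sigma(\langle F\mid x\rangle)=\{g(x):g\in\mathrm{G}_F\}$; two types are equal iff they have the same sockel and typeset. A bundle is a set $\mathcal B=\{\underline B_j:j\in n\}$ of distinct types with a common sockel $\iota(\mathcal B)$; $\sigma(\mathcal B)=\bigcup_j\sigma(\underline B_j)$. An embedding of $\mathcal B$ is a map $f:\iota(\mathcal B)\cup\sigma(\mathcal B)\to\iota(\mathcal B)\cup\sigma(\mathcal B)$ such that for every finite $A$ in its domain some $g\in\mathrm{G}_{\iota(\mathcal B)}$ agrees with $f$ on $A$; a copy of $\mathcal B$ is the image of such an embedding. For $S\subseteq\sigma(\mathcal B)$, $\overline\rho(S)$ is the set of finite $A\subseteq\sigma(\mathcal B)$ with $g[A]\subseteq S$ for some $g\in\mathrm{G}_{\iota(\mathcal B)}$. *)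

(* Defs.v *)
From HB Require Import structures.
From mathcomp Require Import all_boot finmap.
From mathcomp Require Import boolp classical_sets.

Set Implicit Arguments.
Unset Strict Implicit.
Unset Printing Implicit Defensive.

Local Open Scope classical_set_scope.

Record language := Language {
  symbol : Type;
  arity : symbol -> nat;
  arity_gt0 : forall s, 0 < arity s
}.

Record structure (L : language) (T : eqType) := Structure {
  rel_of :> forall s : symbol L, (arity s).-tuple T -> Prop;
  rel_uniq : forall (s : symbol L) (t : (arity s).-tuple T),
    rel_of t -> uniq t
}.

Arguments rel_of {L T} _ s t.

Section Induced.
Variables (L : language) (T : eqType) (P : pred T) (S : subEqType P).
Variable M : structure L T.

Definition induced_rel (s : symbol L) (t : (arity s).-tuple S) : Prop :=
  M s (map_tuple val t).

Lemma induced_rel_uniq s (t : (arity s).-tuple S) : induced_rel t -> uniq t.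
Proof. by move=> /rel_uniq; rewrite (map_inj_uniq val_inj). Qed.

(* [S] may be [{x | P x}], or the subtype attached to a [{fset T}]. *)
Definition induced : structure L S := Structure induced_rel_uniq.
End Induced.

Arguments induced {L T P} S M.

Definition preserves_rel (L : language) (T T' : eqType)
    (M : structure L T) (M' : structure L T') (f : T -> T') : Prop :=
  forall (s : symbol L) (t : (arity s).-tuple T),
    M s t <-> M' s (map_tuple f t).

Definition embeds (L : language) (T T' : eqType)
    (M : structure L T) (M' : structure L T') (f : T -> T') : Prop :=
  injective f /\ preserves_rel M M' f.

Definition isomorphism (L : language) (T T' : eqType)
    (M : structure L T) (M' : structure L T') (f : T -> T') : Prop :=
  bijective f /\ preserves_rel M M' f.

Definition automorphism (L : language) (T : eqType) (M : structure L T)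
  (g : T -> T) : Prop := isomorphism M M g.

Definition homogeneous (L : language) (U : choiceType) (M : structure L U) :
    Prop :=
  forall (A B : {fset U}) (f : A -> B),
    isomorphism (induced A M) (induced B M) f ->
    exists2 g : U -> U, automorphism M g & forall x : A, g (val x) = val (f x).

Definition finite_class (L : language) :=
  forall T : finType, structure L T -> Prop.

Definition age (L : language) (U : eqType) (M : structure L U) :
    finite_class L :=
  fun T A => exists f : T -> U, embeds A M f.

Section FreeAmalgam.
Variables (L : language) (T : finType) (X Y : {set T}).
Variable A : structure L {x : T | x \in X}.
Variable B : structure L {y : T | y \in Y}.

Definition agree : Prop :=
  forall (s : symbol L) (a : (arity s).-tuple {x : T | x \in X})
         (b : (arity s).-tuple {y : T | y \in Y}),
    map_tuple val a = map_tuple val b -> (A s a <-> B s b).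

(* Every related tuple lies entirely in [X] or entirely in [Y], so none meets
   both [X :\: Y] and [Y :\: X]. *)
Definition free_amalgam_rel (s : symbol L) (t : (arity s).-tuple T) : Prop :=
  (exists2 a : (arity s).-tuple {x : T | x \in X},
     A s a & t = map_tuple val a) \/
  (exists2 b : (arity s).-tuple {y : T | y \in Y},
     B s b & t = map_tuple val b).

Lemma free_amalgam_rel_uniq s (t : (arity s).-tuple T) :
  free_amalgam_rel t -> uniq t.
Proof.
by case=> -[a /rel_uniq a_uniq ->]; rewrite (map_inj_uniq val_inj).
Qed.

Definition free_amalgam : structure L T := Structure free_amalgam_rel_uniq.
End FreeAmalgam.

Definition closed_under_induced (L : language) (K : finite_class L) : Prop :=
  forall (T : finType) (A : structure L T) (X : {set T}),
    K T A -> K _ (induced {x : T | x \in X} A).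

Definition closed_under_free_amalgams (L : language) (K : finite_class L) :
    Prop :=
  forall (T : finType) (X Y : {set T})
         (A : structure L {x : T | x \in X})
         (B : structure L {y : T | y \in Y}),
    (forall z : T, (z \in X) || (z \in Y)) ->
    agree A B -> K _ A -> K _ B -> K T (free_amalgam A B).

Definition free_amalgamation_age (L : language) (K : finite_class L) : Prop :=
  closed_under_induced K /\ closed_under_free_amalgams K.

Definition stabilizer (L : language) (U : choiceType) (M : structure L U)
    (F : {fset U}) : set (U -> U) :=
  [set g | automorphism M g /\ forall x, x \in F -> g x = x].

Record otype (U : choiceType) := OType {
  sockel : {fset U};
  point : U;
  point_notin : point \notin sockel
}.

Definition typeset (L : language) (U : choiceType) (M : structure L U)
    (p : otype U) : set U :=
  [set g (point p) | g in stabilizer M (sockel p)].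

Definition same_type (L : language) (U : choiceType) (M : structure L U)
    (p q : otype U) : Prop :=
  sockel p = sockel q /\ typeset M p = typeset M q.

(* The sockel is a field, so that it is also meaningful when [n = 0]. *)
Record bundle (L : language) (U : choiceType) (M : structure L U) (n : nat) :=
  Bundle {
    bsockel : {fset U};
    btype :> 'I_n -> otype U;
    btype_sockel : forall j, sockel (btype j) = bsockel;
    btype_distinct : forall j k, j != k -> ~ same_type M (btype j) (btype k)
  }.

Section Bundles.
Variables (L : language) (U : choiceType) (M : structure L U) (n : nat).
Variable B : bundle M n.

Definition btypeset : set U :=
  \bigcup_(j in [set: 'I_n]) typeset M (B j).

Definition bdomain : set U := [set` bsockel B] `|` btypeset.

(* Only the restriction of [f] to [bdomain] matters. *)
Definition bembedding (f : U -> U) : Prop :=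
  (forall x, bdomain x -> bdomain (f x)) /\
  forall A : {fset U}, [set` A] `<=` bdomain ->
    exists2 g, stabilizer M (bsockel B) g & forall x, x \in A -> f x = g x.

Definition bcopy (C : set U) : Prop :=
  exists2 f, bembedding f & C = f @` bdomain.

Definition rhobar (S : set U) : set {fset U} :=
  [set A | [set` A] `<=` btypeset /\
    exists2 g, stabilizer M (bsockel B) g & g @` [set` A] `<=` S].

(* The index set 2 is [bool]; a block of a partition may be empty. *)
Definition weakly_indivisible : Prop :=
  forall P : bool -> 'I_n -> set U,
    (forall j, P false j `|` P true j = typeset M (B j) /\
               P false j `&` P true j = set0) ->
    exists (J : {set 'I_n}) (eps' : 'I_n -> bool) (C : set U),
      [/\ bcopy C,
          forall j, j \in J -> C `&` typeset M (B j) `<=` P (eps' j) j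
        & forall eps : 'I_n -> bool, (forall j, j \in J -> eps j = eps' j) ->
            rhobar ((\bigcup_(j in [set: 'I_n]) P (eps j) j) `&` C)
            = rhobar btypeset].
End Bundles.

(* Main.v *)
(** For finite sets containing [Z], say that [X] and [Y] are independent over
    [Z] when they meet in [Z] and form a free amalgam over it.  Free
    amalgamation and homogeneity give every finite [Y] a copy over [Z] which is
    independent from a given [X].

    Let [F] be the sockel.  Call colour [i] frequent for the type [j] when, for
    every finite [T], there are [E] independent from [T] over [F], [S]
    containing [E], and a type over [E] of points of sort [j], all of whose
    realizations free from [S] have colour [i].  Frequent colours can be forced
    simultaneously on all points of a finite [A], because the parameter sets
    [E] can be attached freely to the points of [A].  If [i] is not frequent for
    [j], as witnessed by [T], then any type of sort [j] over a set independent
    from [T] has a realization, again free from [T], of the other colour.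

    Let [J] consist of the types for which some colour is not frequent, and let
    [eps'] avoid such a colour on [J].  The copy is built in countably many
    finite steps, staying independent from the witnesses: it adds points one at
    a time, with the prescribed colour when their sort lies in [J], and, for
    each [A] and [eps], adds a new copy of [A] whose points of sort outside [J]
    are placed first, by forcing. *)

From mathcomp Require Import all_boot finmap boolp classical_sets.
Require Import Defs.

Set Implicit Arguments.
Unset Strict Implicit.
Unset Printing Implicit Defensive.

Local Open Scope fset_scope.

(** * The group of automorphisms *)

Section Automorphisms.
Variables (L : language) (U : eqType) (M : structure L U).

Lemma automorphism_id : automorphism M id.
Proof.
split=> [|s t]; first by exists id.
by have -> : map_tuple id t = t by apply: val_inj; rewrite /= map_id.
Qed.

Lemma automorphism_comp g h :
  automorphism M g -> automorphism M h -> automorphism M (g \o h).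
Proof.
move=> [bij_g Mg] [bij_h Mh]; split=> [|s t]; first exact: bij_comp.
rewrite (Mh s t) (Mg s (map_tuple h t)).
suff -> : map_tuple g (map_tuple h t) = map_tuple (g \o h) t by [].
by apply: val_inj; rewrite /= map_comp.
Qed.

Lemma automorphism_inv g : automorphism M g ->
  exists2 g', automorphism M g' & cancel g g' /\ cancel g' g.
Proof.
move=> [[g' gK g'K] Mg]; exists g' => //; split=> [|s t]; first by exists g.
rewrite (Mg s (map_tuple g' t)).
suff -> : map_tuple g (map_tuple g' t) = t by [].
by apply: val_inj; rewrite /= mapK.
Qed.

Lemma automorphism_inj g : automorphism M g -> injective g.
Proof. by case=> /bij_inj. Qed.

End Automorphisms.

Lemma tuple_subP (T : finType) (W : {set T}) n (t : n.-tuple T) :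
  {subset t <= W} ->
  exists a : n.-tuple {x : T | x \in W}, t = map_tuple val a.
Proof.
move=> tW; have tnthW i : tnth t i \in W by apply/tW/mem_tnth.
exists [tuple exist (fun x => x \in W) (tnth t i) (tnthW i) | i < n].
by apply: eq_from_tnth => i; rewrite tnth_map tnth_mktuple.
Qed.

(** Each inclusion in the context is consumed and instantiated at the point [x]; the goal is then a
    tautology in the memberships of [x]. A preceding [clear] keeps the case split small. *)
Ltac fsubset_tauto :=
  let x := fresh "x" in
  move=> x; rewrite ?inE;
  repeat match goal with
    H : {subset _ <= _} |- _ => move/(_ x)/implyP: H; rewrite ?inE
  end;
  repeat (case: (x \in _) => //=; rewrite ?andbF ?orbF ?orbT //=).

(** * Calculus of free independence *)

Section Independence.
Variables (L : language) (U : choiceType) (M : structure L U).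
Implicit Types (X Y Z W : {fset U}) (g h : U -> U).

Definition indep Z X Y : Prop :=
  [/\ {subset Z <= X}, {subset Z <= Y}, forall x, x \in X -> x \in Y -> x \in Z
    & forall s (t : (arity s).-tuple U), M s t -> {subset t <= X `|` Y} ->
      {subset t <= X} \/ {subset t <= Y}].

Lemma indepC Z X Y : indep Z X Y -> indep Z Y X.
Proof.
case=> ZX ZY XYZ XY; split=> // [x Yx Xx|s t Mt tXY]; first exact: XYZ.
by have [x /tXY||] := XY s t Mt; rewrite ?inE; [rewrite orbC | right | left].
Qed.

(** The base may lose points that lie in neither smaller side. If a related tuple lies in [X], its
    points in [Y'] are in both [X] and [Y], hence in [Z], hence in [Z'] and so in [X']. *)
Lemma indep_shrink Z Z' X X' Y Y' :
    {subset X' <= X} -> {subset Y' <= Y} ->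
    {subset Z' <= X'} -> {subset Z' <= Y'} ->
    (forall x, x \in Z -> x \in X' -> x \in Z') ->
    (forall x, x \in Z -> x \in Y' -> x \in Z') ->
  indep Z X Y -> indep Z' X' Y'.
Proof.
move=> X'X Y'Y Z'X' Z'Y' ZX' ZY' [_ _ XYZ XY].
split=> // [x X'x Y'x|s t Mt tXY].
  by apply: ZX' => //; apply: XYZ; [apply: X'X | apply: Y'Y].
have [x /tXY|tX|tY] := XY s t Mt.
- by rewrite !inE => /orP[/X'X->|/Y'Y->] //; rewrite orbT.
- left=> x tx; have := tXY x tx; rewrite inE => /orP[//|Y'x].
  by apply/Z'X'/ZY' => //; apply: XYZ; [apply: tX | apply: Y'Y].
- right=> x tx; have := tXY x tx; rewrite inE => /orP[X'x|//].
  by apply/Z'Y'/ZX' => //; apply: XYZ; [apply: X'X | apply: tY].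
Qed.

Lemma indep_sub Z X Y X' Y' :
    {subset X' <= X} -> {subset Y' <= Y} ->
    {subset Z <= X'} -> {subset Z <= Y'} ->
  indep Z X Y -> indep Z X' Y'.
Proof. by move=> XX YY ZX ZY; apply: indep_shrink. Qed.

(** A related tuple that is not inside [W] lies in the union of [X] and [Y], where the first
    independence splits it. *)
Lemma indep_trans Z X Y W :
  indep Z X Y -> indep X W (X `|` Y) -> indep Z W Y.
Proof.
move=> [ZX ZY XYZ XY] [XW _ WXY W_XY]; split=> // [x /ZX/XW //|x Wx Yx|s t Mt tWY].
  by apply: XYZ => //; apply: WXY; rewrite // inE Yx orbT.
have [x /tWY|tW|tXY] := W_XY s t Mt; last 2 first.
- by left.
- by have [tX|tY] := XY s t Mt tXY; [left=> x /tX/XW | right].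
by rewrite !inE => /orP[->|->]; rewrite ?orbT.
Qed.

(** Base monotonicity: the points added to the base already belong to [Y], so no new tuple has to be
    split. *)
Lemma indep_base Z Z' X Y : {subset Z <= Z'} -> {subset Z' <= Y} ->
  indep Z X Y -> indep Z' (Z' `|` X) Y.
Proof.
move=> ZZ' Z'Y [ZX ZY XYZ XY]; split=> // [x|x|s t Mt tXY].
- by rewrite inE => ->.
- by rewrite inE => /orP[//|Xx] Yx; apply/ZZ'/XYZ.
have [x /tXY|tX|tY] := XY s t Mt; [|by left=> x /tX; rewrite inE orbC => ->|by right].
by rewrite !inE -orbA => /or3P[/Z'Y->|->|->]; rewrite ?orbT.
Qed.

Lemma indep_image g Z X Y : automorphism M g ->
  indep Z X Y -> indep (g @` Z) (g @` X) (g @` Y).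
Proof.
move=> aut_g [ZX ZY XYZ XY].
have [g' aut_g' [gK g'K]] := automorphism_inv aut_g.
have mem_g V x : (x \in g @` V) = (g' x \in V).
  apply/imfsetP/idP=> [[y Vy ->]|Vx]; first by rewrite gK.
  by exists (g' x); rewrite ?g'K.
split=> [x|x|x|s t]; rewrite ?mem_g; [exact: ZX | exact: ZY | exact: XYZ |].
case: aut_g' => _ /(_ s t)-> Mt tXY.
have [_ /mapP[x tx ->]|tX|tY] := XY s _ Mt.
- by have := tXY x tx; rewrite !inE !mem_g.
- by left=> x tx; rewrite mem_g; apply/tX/map_f.
- by right=> x tx; rewrite mem_g; apply/tY/map_f.
Qed.

Lemma fix_image g Z : {in Z, g =1 id} -> g @` Z = Z.
Proof.
move=> gZ; apply/fsetP=> x; apply/imfsetP/idP=> [[y Zy ->]|Zx].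
  by rewrite gZ.
by exists x; rewrite ?gZ.
Qed.

(** * Homogeneity and gluing of automorphisms *)

Hypothesis hom : homogeneous M.

(** Homogeneity for a partial isomorphism given as a function on all of [U], so that later arguments
    need no subtypes. *)
Lemma extend_partial_iso X (f : U -> U) : {in X &, injective f} ->
    (forall s (t : (arity s).-tuple U), {subset t <= X} ->
       (M s t <-> M s (map_tuple f t))) ->
  exists2 g, automorphism M g & {in X, g =1 f}.
Proof.
move=> f_inj Mf.
have fX (x : X) : f (val x) \in f @` X by apply: in_imfset; apply: valP.
pose F (x : X) : f @` X := [` fX x].
have F_inj : injective F.
  move=> x y /(congr1 val) /= fxy; apply: val_inj.
  by apply: f_inj => //; apply: valP.
have F_surj (y : f @` X) : exists x, F x == y.
  have /imfsetP[x Xx yE] := valP y.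
  by exists [` Xx]; apply/eqP/val_inj; rewrite yE.
have [] := hom (f := F).
  split=> [|s t].
    exists (fun y => xchoose (F_surj y)) => [x|y].
      by apply: F_inj; apply/eqP; apply: (xchooseP (F_surj (F x))).
    by apply/eqP; apply: (xchooseP (F_surj y)).
  rewrite /= /induced_rel Mf; last by move=> _ /mapP[x _ ->]; apply: valP.
  suff -> : map_tuple f (map_tuple val t) = map_tuple val (map_tuple F t) by [].
  by apply: val_inj; rewrite /= -!map_comp.
by move=> g aut_g gF; exists g => // x Xx; have := gF [` Xx].
Qed.

(** The union of the restrictions to [X] and [Y] is a partial isomorphism: independence in the
    source and in the target puts every related tuple on one side, where [g1] or [g2] alone
    preserves it. *)
Lemma glue g1 g2 Z X Y :
    automorphism M g1 -> automorphism M g2 -> {in Z, g1 =1 g2} ->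
    indep Z X Y -> indep (g1 @` Z) (g1 @` X) (g2 @` Y) ->
  exists g, [/\ automorphism M g, {in X, g =1 g1} & {in Y, g =1 g2}].
Proof.
move=> aut1 aut2 g12 [ZX ZY XYZ XY] [_ _ gXYZ gXY].
pose f x := if x \in X then g1 x else g2 x.
have fX : {in X, f =1 g1} by rewrite /f => x ->.
have fY : {in Y, f =1 g2}.
  by rewrite /f => x Yx; case: ifP => // Xx; apply/g12/XYZ.
have inj1 := automorphism_inj aut1; have inj2 := automorphism_inj aut2.
(* The two images meet only in the image of [Z], where [g1] and [g2] agree. *)
have cross x y : x \in X -> y \in Y -> g1 x = g2 y -> x = y.
  move=> Xx Yy gxy.
  have /imfsetP[z Zz gxz] : g1 x \in g1 @` Z.
    by apply: gXYZ; [rewrite in_imfset | rewrite gxy in_imfset].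
  have xz := inj1 _ _ gxz; rewrite {}xz in gxy Xx *.
  by apply: inj2; rewrite -gxy -g12.
have [|s t tXY|g aut_g gf] := extend_partial_iso (X := X `|` Y) (f := f).
- move=> x y; rewrite !inE.
  move=> /orP[Ax|Ax] /orP[Ay|Ay]; rewrite ?(fX _ Ax) ?(fX _ Ay) ?(fY _ Ax) ?(fY _ Ay).
  + exact: inj1.
  + exact: cross.
  + by move/esym/cross->.
  + exact: inj2.
- have mapE h (V : {fset U}) : {in V, f =1 h} -> {subset t <= V} ->
      map_tuple f t = map_tuple h t.
    by move=> fh tV; apply: val_inj; apply/eq_in_map => x /tV/fh.
  have eqX : {subset t <= X} -> (M s t <-> M s (map_tuple f t)).
    by move=> tX; rewrite (mapE _ _ fX tX); case: aut1.
  have eqY : {subset t <= Y} -> (M s t <-> M s (map_tuple f t)).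
    by move=> tY; rewrite (mapE _ _ fY tY); case: aut2.
  split=> Mt.
    by have [//|tX|tY] := XY s t Mt; [apply/eqX | apply/eqY].
  have [_ /mapP[x tx ->]|tX|tY] := gXY s _ Mt.
  + have := tXY x tx; rewrite !inE => /orP[Xx|Yx].
      by rewrite fX // in_imfset.
    by rewrite fY // (in_imfset _ g2 Yx) orbT.
  + apply/eqX => // x tx; have := tXY x tx; rewrite inE => /orP[//|Yx].
    have /imfsetP[y Xy] := tX _ (map_f f tx).
    by rewrite fY // => /esym/cross <-.
  + apply/eqY => // x tx; have := tXY x tx; rewrite inE => /orP[Xx|//].
    have /imfsetP[y Yy] := tY _ (map_f f tx).
    by rewrite fX // => /cross ->.
exists g; split=> // x Ax; rewrite gf ?inE ?Ax ?orbT //; [exact: fX | exact: fY].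
Qed.

(** * Free copies from free amalgamation *)

Hypothesis free : free_amalgamation_age (age M).

(* The two sides live on [X * {false}] and [(Y \ Z) * {true}], so that their
   common part is exactly [Z] even when [X] and [Y] share other points. *)
Lemma free_copy Z X Y : {subset Z <= X} -> {subset Z <= Y} ->
  exists2 g, stabilizer M Z g & indep Z X (g @` Y).
Proof.
move=> ZX ZY.
pose V : {fset U * bool} :=
  [fset (x, false) | x in X] `|` [fset (y, true) | y in Y `\` Z].
pose XV : {set V} := [set v : V | (val v).1 \in X & ~~ (val v).2].
pose YV : {set V} := [set v : V | ((val v).1 \in Y) && ((val v).2 || ((val v).1 \in Z))].
have VE x b : ((x, b) \in V) = if b then (x \in Y) && (x \notin Z) else x \in X.
  rewrite inE; apply/orP/idP => [[]/imfsetP[y /= y_in [-> ->]] //|].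
    by move: y_in; rewrite !inE andbC.
  case: b => [/andP[Yx Zx]|Xx]; [right | left]; apply/imfsetP; exists x => //.
  by rewrite !inE Zx.
have V_inP (v : V) : (val v).1 \in (if (val v).2 then Y `\` Z else X).
  by have := valP v; case: (val v) => x [] /=; rewrite VE ?inE // andbC.
(* Both sides carry the structure pulled back along the first projection. This projection is
   injective on each side, so both belong to the age, and [f] below embeds their free amalgam. *)
pose pull (W : {set V}) s (t : (arity s).-tuple {v : V | v \in W}) :=
  M s (map_tuple (fun v => (val (val v)).1) t).
have pull_uniq (W : {set V}) s (t : (arity s).-tuple {v : V | v \in W}) : pull W s t -> uniq t.
  by move/rel_uniq/map_uniq.
pose PS (W : {set V}) := Structure (@pull_uniq W).
have XV2 : {in XV, forall v, (val v).2 = false}.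
  by move=> v; rewrite inE => /andP[_ /negbTE].
have YV2 : {in YV, forall v, (val v).2 = ((val v).1 \notin Z)}.
  move=> v; rewrite inE => /andP[_]; have := V_inP v.
  by case: (val v).2 => /= [|_ ->] //; rewrite inE => /andP[->].
have pair_inj (v w : V) : (val v).1 = (val w).1 -> (val v).2 = (val w).2 -> v = w.
  by move=> e1 e2; apply: val_inj; rewrite [LHS]surjective_pairing e1 e2 -surjective_pairing.
have X_inj : {in XV &, injective (fun v : V => (val v).1)}.
  by move=> v w Xv Xw vw; apply: pair_inj; rewrite ?XV2.
have Y_inj : {in YV &, injective (fun v : V => (val v).1)}.
  by move=> v w Yv Yw vw; apply: pair_inj; rewrite ?YV2 ?vw.
have [f [f_inj Mf]] : age M (free_amalgam (PS XV) (PS YV)).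
  apply: (proj2 free).
  - move=> v; have := V_inP v; rewrite !inE; case: (val v) => x [] /=; rewrite ?inE.
      by case/andP=> _ ->; rewrite orbT.
    by move=> ->.
  - move=> s a b ab; rewrite /= /pull.
    suff -> : map_tuple (fun v => (val (val v)).1) a =
              map_tuple (fun v => (val (val v)).1) b by [].
    apply: val_inj; move/(congr1 val): ab => /= ab.
    by rewrite (map_comp (fun v : V => (val v).1) val) ab -map_comp.
  - by exists (fun v => (val (val v)).1); split=> // v w /X_inj vw; apply/val_inj/vw; apply: valP.
  - by exists (fun v => (val (val v)).1); split=> // v w /Y_inj vw; apply/val_inj/vw; apply: valP.
have relE (s : symbol L) (t : (arity s).-tuple V) :
    {subset t <= XV} \/ {subset t <= YV} ->
    (M s (map_tuple f t) <-> M s (map_tuple (fun v => (val v).1) t)).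
  have pullE (W : {set V}) (a : (arity s).-tuple {v : V | v \in W}) :
      map_tuple (fun v => (val v).1) (map_tuple val a) =
      map_tuple (fun v => (val (val v)).1) a.
    by apply: val_inj; rewrite /= -map_comp.
  move=> tW; rewrite -(Mf s t); split=> [[] [a] Aa ->|Mt]; rewrite ?pullE //.
  by case: tW => /tuple_subP[a tE]; [left | right]; exists a => //;
    rewrite /= /pull -pullE -tE.
(* On one side, [f] is a partial isomorphism in terms of first coordinates, so it extends to an
   automorphism: [p] for [X] and [q] for [Y]. *)
have lift (W : {set V}) : W = XV \/ W = YV -> {in W &, injective (fun v : V => (val v).1)} ->
    exists2 p, automorphism M p & {in W, forall v, p (val v).1 = f v}.
  move=> WXY fst_inj.
  pose f0 x := if [pick v in W | (val v).1 == x] is Some v then f v else x.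
  have f0E : {in W, forall v, f0 (val v).1 = f v}.
    move=> v Wv; rewrite /f0; case: pickP => [w /andP[Ww /eqP wv]|/(_ v)].
      by rewrite (fst_inj w v).
    by rewrite Wv eqxx.
  have [x y /imfsetP[v /= Wv ->] /imfsetP[w /= Ww ->]|s t tW|p aut_p pf0] :=
    extend_partial_iso (X := [fset (val v).1 | v in W]) (f := f0).
  - by rewrite !f0E // => /f_inj ->.
  - have tW' i : exists v, (v \in W) && ((val v).1 == tnth t i).
      have /imfsetP[v /= Wv ->] := tW _ (mem_tnth i t).
      by exists v; rewrite Wv eqxx.
    pose t' := [tuple xchoose (tW' i) | i < arity s].
    have tE : t = map_tuple (fun v : V => (val v).1) t'.
      apply: eq_from_tnth => i; rewrite tnth_map tnth_mktuple.
      by have /andP[_ /eqP->] := xchooseP (tW' i).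
    have t'W : {subset t' <= W}.
      by move=> _ /tnthP[i ->]; rewrite tnth_mktuple; have /andP[] := xchooseP (tW' i).
    have -> : map_tuple f0 t = map_tuple f t'.
      by rewrite tE; apply: val_inj; rewrite /= -map_comp; apply/eq_in_map => v /t'W/f0E.
    rewrite relE -?tE //.
    by case: WXY t'W => ->; [left | right].
  exists p => // v Wv; rewrite pf0 ?f0E //; exact: in_imfset.
have [p aut_p pf] := lift XV (or_introl erefl) X_inj.
have [q aut_q qf] := lift YV (or_intror erefl) Y_inj.
have pX x : x \in X -> exists v, [&& v \in XV, (val v).1 == x & f v == p x].
  move=> Xx; have Vx : (x, false) \in V by rewrite VE.
  have XVx : [` Vx] \in XV by rewrite inE /= Xx.
  by exists [` Vx]; rewrite XVx /= eqxx -(pf _ XVx) /= eqxx.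
have qY y : y \in Y -> exists v, [&& v \in YV, (val v).1 == y & f v == q y].
  move=> Yy; have Vy : (y, y \notin Z) \in V.
    by rewrite VE Yy /=; case: ifPn => // /negPn/ZX.
  have YVy : [` Vy] \in YV by rewrite inE /= Yy orNb.
  by exists [` Vy]; rewrite YVy /= eqxx -(qf _ YVy) /= eqxx.
(* A coincidence comes from one vertex lying on both sides, and such a vertex has tag [false] and
   first coordinate in [Z]. *)
have pq_eq x y : x \in X -> y \in Y -> p x = q y -> x = y /\ x \in Z.
  move=> /pX[v /and3P[Xv /eqP<- /eqP<-]] /qY[w /and3P[Yw /eqP<- /eqP<-]] /f_inj vw.
  rewrite -{}vw in Yw *; split=> //.
  by have := YV2 _ Yw; rewrite (XV2 _ Xv) => /esym/negbFE.
have pqZ : {in Z, p =1 q}.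
  move=> z Zz; have /pX[v /and3P[Xv /eqP vz /eqP<-]] := ZX _ Zz.
  by rewrite -vz -qf // inE XV2 // vz ZY.
have [p' aut_p' [pK p'K]] := automorphism_inv aut_p.
have [q' aut_q' [qK q'K]] := automorphism_inv aut_q.
(* Applying the inverse of [p] returns the embedded copy of [X] to its place and leaves that of [Y]
   free from it. *)
exists (p' \o q).
  by split=> [|z Zz /=]; [apply: automorphism_comp | rewrite -pqZ ?pK].
split=> // [z Zz|x Xx|s t Mt tXY].
- by apply/imfsetP; exists z; rewrite ?ZY //= -pqZ ?pK.
- by case/imfsetP=> y /= Yy xE; apply: (proj2 (pq_eq x y Xx Yy _)); rewrite xE p'K.
(* The tuple, moved by [p], lies in the image of [f]; its preimage [t'] is related in the amalgam,
   which tells on which side it lies. *)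
have tP i : exists v, f v == p (tnth t i).
  have := tXY _ (mem_tnth i t); rewrite inE => /orP[/pX[v /and3P[_ _ fv]]|].
    by exists v.
  case/imfsetP=> y /= /qY[v /and3P[_ _ fv]] ->.
  by exists v; rewrite p'K.
pose t' := [tuple xchoose (tP i) | i < arity s].
have t'E i : f (tnth t' i) = p (tnth t i).
  by rewrite tnth_mktuple; apply/eqP/(xchooseP (tP i)).
have ft' : map_tuple f t' = map_tuple p t.
  by apply: eq_from_tnth => i; rewrite [LHS]tnth_map [RHS]tnth_map t'E.
have : free_amalgam (PS XV) (PS YV) s t' by apply/(Mf s t'); rewrite ft'; apply/(proj2 aut_p s t).
have t'_mem (W : {set V}) (a : (arity s).-tuple {v : V | v \in W}) i :
    t' = map_tuple val a -> tnth t' i \in W.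
  by move->; rewrite tnth_map; apply: valP.
case=> -[a _ /t'_mem t'W]; [left | right] => _ /tnthP[i ->].
  have := t'W i; move: (t'E i); move: (tnth t' i) => v fv Xv.
  move: fv; rewrite -pf // => /(automorphism_inj aut_p) <-.
  by move: Xv; rewrite inE => /andP[].
have := t'W i; move: (t'E i); move: (tnth t' i) => v fv Yv.
apply/imfsetP; exists (val v).1; first by move: Yv; rewrite inE => /andP[].
by rewrite /= qf // fv pK.
Qed.


Lemma stabilizer_id Z : stabilizer M Z id.
Proof. by split=> //; apply: automorphism_id. Qed.

Lemma stabilizer_comp Z g h :
  stabilizer M Z g -> stabilizer M Z h -> stabilizer M Z (g \o h).
Proof.
move=> [aut_g gZ] [aut_h hZ]; split; first exact: automorphism_comp.
by move=> x Zx; rewrite /= hZ ?gZ.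
Qed.

Lemma stabilizer_inv Z g : stabilizer M Z g ->
  exists2 g', stabilizer M Z g' & cancel g g' /\ cancel g' g.
Proof.
move=> [aut_g gZ]; have [g' aut_g' [gK g'K]] := automorphism_inv aut_g.
by exists g'; do !split=> // x Zx; rewrite -{1}(gZ x Zx) gK.
Qed.

Lemma stabilizer_sub Z Z' g : {subset Z' <= Z} ->
  stabilizer M Z g -> stabilizer M Z' g.
Proof. by move=> Z'Z [aut_g gZ]; split=> // x /Z'Z/gZ. Qed.

Lemma stabilizer_image Z g : stabilizer M Z g -> g @` Z = Z.
Proof. by case=> _ gZ; apply: fix_image. Qed.

(** * Forcing colours on finite sets *)

Variable F : {fset U}.

(* [E] forces the points of [A]: whenever a copy of [A] over [E] is placed
   freely from [S], every point [a] of it lands in [Q a]. *)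
Definition forced (A : {fset U}) (Q : U -> set U) : Prop :=
  forall T, {subset F <= T} -> exists E S h,
    [/\ {subset E <= S}, indep F E T, stabilizer M F h,
        forall a, a \in A -> h a \notin E
      & forall g, stabilizer M E g -> indep E (E `|` (g \o h) @` A) S ->
        forall a, a \in A -> Q a (g (h a))].

Lemma forced0 Q : forced fset0 Q.
Proof.
move=> T FT; exists F, F, id; split=> //; last exact: stabilizer_id.
by split=> // s t Mt tT; right=> x /tT; rewrite inE => /orP[/FT|].
Qed.

(** A copy over [E] free from both [S] and [T] serves twice: freeness from [S] triggers the forcing,
    and freeness from [T] passes down to the base [F] by transitivity. *)
Lemma forced_realized A Q T : forced A Q -> {subset F <= T} ->
  exists g, [/\ stabilizer M F g, indep F (F `|` g @` A) T
                & forall a, a \in A -> Q a (g a)].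
Proof.
move=> fA FT; have [E [S [h [ES FET Fh _ Eh]]]] := fA T FT.
have [FE _ _ _] := FET.
have [q Eq qind] := @free_copy E (S `|` T) (E `|` h @` A) ltac:(fsubset_tauto) ltac:(fsubset_tauto).
have qE : q @` (E `|` h @` A) = E `|` (q \o h) @` A.
  by rewrite imfsetU (stabilizer_image Eq) -imfset_comp.
rewrite {}qE in qind.
exists (q \o h); split.
- by apply: stabilizer_comp => //; apply: stabilizer_sub Eq.
- have ind_E : indep E (E `|` (q \o h) @` A) (E `|` T).
    by apply/indepC; apply: indep_sub qind; fsubset_tauto.
  by apply: indep_sub (indep_trans FET ind_E); fsubset_tauto.
- by apply: Eh => //; apply/indepC; apply: indep_sub qind; fsubset_tauto.
Qed.

(** The union of [E1] and [E2] is the new parameter set. With [E2] attached freely to the rest, a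
    placement of both sets that is free from [S1] and [S2] restricts to a free placement of [A] over
    [E1] and of [B] over [E2]. *)
Lemma forcedU A B Q : (forall a, a \in A -> a \notin B) ->
  forced A Q -> forced B Q -> forced (A `|` B) Q.
Proof.
move=> AB fA fB T FT.
have [E1 [S1 [h1 [ES1 FE1T Fh1 h1E1 force1]]]] := fA T FT.
have FTS1 : {subset F <= T `|` S1} by fsubset_tauto.
(* [E2] is chosen free from [S1] as well, hence from its subset [E1]. *)
have [E2 [S2 [h2 [ES2 FE2T Fh2 h2E2 force2]]]] := fB _ FTS1.
have [FE1 _ _ _] := FE1T; have [FE2 _ _ _] := FE2T.
have E12 : indep F E1 E2 by apply/indepC; apply: indep_sub FE2T; fsubset_tauto.
have ET : indep F (E1 `|` E2) T.
  apply: (indep_trans FE1T).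
  apply: (indep_sub (X := E1 `|` E2) (Y := E1 `|` T)); try by fsubset_tauto.
  by apply: (indep_base FE1); [|apply: indep_sub FE2T]; fsubset_tauto.
have [h1' Fh1' [h1K h1'K]] := stabilizer_inv Fh1.
have [h2' Fh2' [h2K h2'K]] := stabilizer_inv Fh2.
have image_sup (h : U -> U) (E : {fset U}) :
    stabilizer M F h -> {subset F <= E} -> {subset F <= h @` E}.
  by move=> [_ hF] FE x Fx; apply/imfsetP; exists x; rewrite ?hF //; apply: FE.
have AF a : a \in A -> a \notin F.
  by move=> /h1E1; apply: contra => Fa; case: Fh1 => _ ->; rewrite ?FE1.
have BF a : a \in B -> a \notin F.
  by move=> /h2E2; apply: contra => Fa; case: Fh2 => _ ->; rewrite ?FE2.
have FW1 := image_sup _ _ Fh1' FE1; have FW2 := image_sup _ _ Fh2' FE2.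
(* Transport [E1] and [E2] to the copies [V1] and [V2] attached to [A] and [B],
   make these independent, then move both back at once by [r]. *)
have [q1 FAq1 ind1] := @free_copy (F `|` A) (F `|` A `|` B) (A `|` h1' @` E1)
  ltac:(fsubset_tauto) ltac:(fsubset_tauto).
have [q2 FBq2 ind2] := @free_copy (F `|` B) (F `|` A `|` B `|` (q1 \o h1') @` E1)
  (B `|` h2' @` E2) ltac:(fsubset_tauto) ltac:(fsubset_tauto).
have Fq1 : stabilizer M F q1 by apply: stabilizer_sub FAq1; fsubset_tauto.
have Fq2 : stabilizer M F q2 by apply: stabilizer_sub FBq2; fsubset_tauto.
have Aq1 : stabilizer M A q1 by apply: stabilizer_sub FAq1; fsubset_tauto.
have Bq2 : stabilizer M B q2 by apply: stabilizer_sub FBq2; fsubset_tauto.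
rewrite imfsetU (stabilizer_image Aq1) -imfset_comp in ind1.
rewrite imfsetU (stabilizer_image Bq2) -imfset_comp in ind2.
set V1 := (q1 \o h1') @` E1 in ind1 ind2.
set V2 := (q2 \o h2') @` E2 in ind2.
have FV1 : {subset F <= V1} by apply: image_sup => //; apply: stabilizer_comp.
have FV2 : {subset F <= V2} by apply: image_sup => //; apply: stabilizer_comp.
have AV1 a : a \in A -> a \notin V1.
  move=> Aa; apply/negP => /imfsetP[e /= Ee aE].
  have := h1E1 a Aa; rewrite (_ : a = h1' e) ?h1'K ?Ee //.
  by apply: (automorphism_inj (proj1 Aq1)); rewrite -aE (proj2 Aq1).
have BV2 a : a \in B -> a \notin V2.
  move=> Ba; apply/negP => /imfsetP[e /= Ee aE].
  have := h2E2 a Ba; rewrite (_ : a = h2' e) ?h2'K ?Ee //.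
  by apply: (automorphism_inj (proj1 Bq2)); rewrite -aE (proj2 Bq2).
have BV1 a : a \in B -> a \notin V1.
  move=> Ba; apply/negP => V1a; case: ind1 => _ _ /(_ a) + _.
  rewrite !inE Ba V1a !orbT (negbTE (BF a Ba)) => /(_ isT isT) /AB.
  by rewrite Ba.
have AV2 a : a \in A -> a \notin V2.
  move=> Aa; apply/negP => V2a; case: ind2 => _ _ /(_ a) + _.
  by rewrite !inE Aa V2a !orbT (negbTE (AF a Aa)) (negbTE (AB a Aa)) => /(_ isT isT).
(* The points of [B] can leave the base because they lie in none of [A], [V1], [V2]. *)
have ind12 : indep F (A `|` V1) V2.
  apply: indep_shrink ind2; try by clear -FV1 FV2; fsubset_tauto.
    move=> x; rewrite !inE => /orP[//|Bx] /orP[/AB|]; first by rewrite Bx.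
    by rewrite (negbTE (BV1 x Bx)).
  by move=> x; rewrite !inE => /orP[//|Bx]; rewrite (negbTE (BV2 x Bx)).
have ind21 : indep F V1 (B `|` V2).
  apply/indepC; apply: (indep_trans (X := F `|` B)).
    apply/indepC; apply: indep_shrink (indepC ind1); try by clear -FV1; fsubset_tauto.
      by move=> x; rewrite !inE => /orP[//|Ax]; rewrite (negbTE (AV1 x Ax)).
    by move=> x; rewrite !inE => /orP[//|Ax]; rewrite (negbTE (AB x Ax)) => /orP[].
  by apply/indepC; apply: indep_sub ind2; clear -FV1 FV2; fsubset_tauto.
have [q1' Fq1' [q1K q1'K]] := stabilizer_inv Fq1.
have [q2' Fq2' [q2K q2'K]] := stabilizer_inv Fq2.
have image1 : (h1 \o q1') @` V1 = E1.
  rewrite -imfset_comp; apply: fix_image => e _ /=; by rewrite q1K h1'K.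
have image2 : (h2 \o q2') @` V2 = E2.
  rewrite -imfset_comp; apply: fix_image => e _ /=; by rewrite q2K h2'K.
have Fr1 : stabilizer M F (h1 \o q1') by apply: stabilizer_comp.
have Fr2 : stabilizer M F (h2 \o q2') by apply: stabilizer_comp.
have [r [aut_r rV1 rV2]] : exists r, [/\ automorphism M r,
    {in V1, r =1 h1 \o q1'} & {in V2, r =1 h2 \o q2'}].
  apply: (glue (Z := F)); [exact: (proj1 Fr1)|exact: (proj1 Fr2)| | | ].
  - by move=> x Fx; rewrite (proj2 Fr1) // (proj2 Fr2).
  - by apply: indep_sub ind12; clear -FV1 FV2; fsubset_tauto.
  - by rewrite image1 image2 (stabilizer_image Fr1).
have rE1 : r @` V1 = E1 by rewrite -image1; apply: eq_in_imfset.
have rE2 : r @` V2 = E2 by rewrite -image2; apply: eq_in_imfset.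
exists (E1 `|` E2), (S1 `|` S2), r; split=> //; first by fsubset_tauto.
- by split=> // x Fx; rewrite rV1 ?(proj2 Fr1) //; apply: FV1.
- have mem_r V a : (r a \in r @` V) = (a \in V).
    by rewrite mem_imfset //; apply: (automorphism_inj aut_r).
  move=> a; rewrite -rE1 -rE2 !inE !mem_r => /orP[Aa|Ba].
    by rewrite (negbTE (AV1 a Aa)) (negbTE (AV2 a Aa)).
  by rewrite (negbTE (BV1 a Ba)) (negbTE (BV2 a Ba)).
(* Common to both halves: [k0] fixes [E0] and turns the position [h0] into [r], so [g \o k0] is a
   test for the original forcing. It is free from [S0] because [r] puts [A0] free from all
   parameters over [E0], and [Eind] then applies by transitivity. *)
have main g (A0 E0 S0 : {fset U}) h0 k0 :
    stabilizer M (E1 `|` E2) g ->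
    indep (E1 `|` E2) (E1 `|` E2 `|` (g \o r) @` (A `|` B)) (S1 `|` S2) ->
    {subset E0 <= E1 `|` E2} -> {subset E0 <= S0} -> {subset S0 <= S1 `|` S2} ->
    {subset A0 <= A `|` B} -> automorphism M k0 -> {in E0, k0 =1 id} ->
    {in A0, forall a, k0 (h0 a) = r a} ->
    indep E0 (E1 `|` E2) (E0 `|` r @` A0) ->
  stabilizer M E0 (g \o k0) /\ indep E0 (E0 `|` (g \o k0 \o h0) @` A0) S0.
  move=> Eg Eind E0E E0S0 S0S A0AB aut_k0 k0E0 k0h0 ind0.
  split; first by apply: (stabilizer_comp (stabilizer_sub E0E Eg)).
  have -> : (g \o k0 \o h0) @` A0 = (g \o r) @` A0.
    by apply: eq_in_imfset => // a /k0h0 /= ->.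
  have gA0 : {subset (g \o r) @` A0 <= (g \o r) @` (A `|` B)}.
    by move=> _ /imfsetP[a /A0AB ABa ->]; apply: in_imfset.
  have := indep_image (proj1 Eg) ind0.
  rewrite (stabilizer_image Eg) imfsetU -imfset_comp.
  rewrite (stabilizer_image (stabilizer_sub E0E Eg)) => ind0g.
  have indS : indep (E1 `|` E2) (S1 `|` S2) (E1 `|` E2 `|` (E0 `|` (g \o r) @` A0)).
    apply/indepC; apply: indep_sub Eind; clear -E0E gA0 ES1 ES2; fsubset_tauto.
  apply/indepC; apply: indep_sub (indep_trans ind0g indS) => //.
  by clear; fsubset_tauto.
have k1E1 : {in E1, r \o q1 \o h1' =1 id}.
  by move=> e Ee; rewrite /= rV1 /= ?q1K ?h1'K //; apply/imfsetP; exists e.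
have k2E2 : {in E2, r \o q2 \o h2' =1 id}.
  by move=> e Ee; rewrite /= rV2 /= ?q2K ?h2'K //; apply/imfsetP; exists e.
have k1h1 : {in A, forall a, (r \o q1 \o h1') (h1 a) = r a}.
  by move=> a Aa; rewrite /= h1K (proj2 Aq1).
have k2h2 : {in B, forall a, (r \o q2 \o h2') (h2 a) = r a}.
  by move=> a Ba; rewrite /= h2K (proj2 Bq2).
have aut_k1 : automorphism M (r \o q1 \o h1').
  exact: automorphism_comp (automorphism_comp aut_r (proj1 Fq1)) (proj1 Fh1').
have aut_k2 : automorphism M (r \o q2 \o h2').
  exact: automorphism_comp (automorphism_comp aut_r (proj1 Fq2)) (proj1 Fh2').
have indE1 : indep E1 (E1 `|` E2) (E1 `|` r @` A).
  rewrite -rE1 -rE2 -!imfsetU; apply: (indep_image aut_r); rewrite [V1 `|` A]fsetUC.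
  by apply: indep_base (indepC ind12); clear -FV1; fsubset_tauto.
have indE2 : indep E2 (E1 `|` E2) (E2 `|` r @` B).
  rewrite [E1 `|` E2]fsetUC -rE1 -rE2 -!imfsetU; apply: (indep_image aut_r).
  by rewrite [V2 `|` B]fsetUC; apply: indep_base ind21; clear -FV2; fsubset_tauto.
move=> g Eg Eind a; rewrite inE => /orP[Aa|Ba].
- have [|||Ek1 ind_k1] := main g A E1 S1 h1 _ Eg Eind _ ES1 _ _ aut_k1 k1E1 k1h1 indE1.
  1-3: by clear; fsubset_tauto.
  by have := force1 _ Ek1 ind_k1 a Aa; rewrite /= h1K (proj2 Aq1).
- have [|||Ek2 ind_k2] := main g B E2 S2 h2 _ Eg Eind _ ES2 _ _ aut_k2 k2E2 k2h2 indE2.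
  1-3: by clear; fsubset_tauto.
  by have := force2 _ Ek2 ind_k2 a Ba; rewrite /= h2K (proj2 Bq2).
Qed.

End Independence.

(** Dependent choice along a list of tasks; task [m] is completed at stage [m.+1]. *)
Lemma increasing_chain (S : Type) (le : S -> S -> Prop) (done : nat -> S -> Prop)
    (s0 : S) :
    (forall s m, exists s', le s s' /\ done m s') ->
  exists s : nat -> S, forall m, le (s m) (s m.+1) /\ done m (s m.+1).
Proof.
move=> step; have [next nextP] := choice (fun sm : S * nat => step sm.1 sm.2).
exists (fix s m := if m is m'.+1 then next (s m', m') else s0) => m.
exact: (nextP (_, m)).
Qed.

(** * From single points to finite sets, and failure of forcing *)

Section Forcing.
Variables (L : language) (U : choiceType) (M : structure L U) (F : {fset U}).
Hypotheses (hom : homogeneous M) (free : free_amalgamation_age (age M)).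

Lemma eq_forced A (Q Q' : U -> set U) :
    (forall a y, a \in A -> Q a y -> Q' a y) ->
  forced M F A Q -> forced M F A Q'.
Proof.
move=> QQ' fA T FT; have [E [S [h [ES ET Fh hE force]]]] := fA T FT.
by exists E, S, h; split=> // g Eg Eind a Aa; apply: QQ' => //; apply: force.
Qed.

(** The same [E] and [S] work: precomposing [h] with the inverse of [k] gives [k p] the position
    that [p] had. *)
Lemma forced_orbit Q k p : stabilizer M F k ->
  forced M F [fset p] (fun=> Q) -> forced M F [fset k p] (fun=> Q).
Proof.
move=> Fk fp T FT; have [E [S [h [ES ET Fh hE force]]]] := fp T FT.
have [k' Fk' [kK k'K]] := stabilizer_inv Fk.
exists E, S, (h \o k'); split=> //; first exact: stabilizer_comp.
  by move=> _ /fset1P->; rewrite /= kK; apply: hE; rewrite inE.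
move=> g Eg Eind _ /fset1P-> /=; rewrite kK; apply: force; rewrite ?inE //.
suff -> : (g \o h) @` [fset p] = (g \o (h \o k')) @` [fset k p] by [].
by rewrite !imfset_fset1 /= kK.
Qed.

Lemma forced_points A Q :
  (forall a, a \in A -> forced M F [fset a] Q) -> forced M F A Q.
Proof.
have seq_case (s : seq U) :
    {in s, forall a, forced M F [fset a] Q} -> forced M F [fset x in s] Q.
  elim: s => [_|a s IHs fas]; first by rewrite fset_nil; apply: forced0.
  have fs : forced M F [fset x in s] Q.
    by apply: IHs => b sb; apply: fas; rewrite inE sb orbT.
  have [sa|sa] := boolP (a \in s).
    suff -> : [fset x in a :: s] = [fset x in s] by [].
    by apply/fsetP=> x; rewrite !inE; case: eqP => // ->.
  rewrite fset_cons; apply: (forcedU hom free) => //.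
    by move=> x /fset1P->; rewrite inE.
  by apply: fas; rewrite mem_head.
have eqA A' : A' =i A -> forced M F A' Q -> forced M F A Q by move=> /fsetP->.
by move=> fA; apply: (eqA _ _ (seq_case (enum_fset A) fA)) => x; rewrite inE.
Qed.

(** The negation of forcing, unwound. Since [S] stays arbitrary, it can later be taken to include
    [T], which keeps the construction independent from [T]. *)
Lemma not_forced Q p : ~ forced M F [fset p] (fun=> Q) ->
  exists2 T, {subset F <= T} &
    forall E S h, {subset E <= S} -> indep M F E T -> stabilizer M F h ->
      h p \notin E -> exists g, [/\ stabilizer M E g,
        indep M E (E `|` [fset g (h p)]) S & ~ Q (g (h p))].
Proof.
move=> nfp; apply: contrapT => noT; apply: nfp => T FT.
apply: contrapT => noE; apply: noT; exists T => // E S h ES ET Fh hE.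
apply: contrapT => nog; apply: noE; exists E, S, h.
split=> // [a /fset1P-> //|g Eg Eind a /fset1P->].
apply: contrapT => nQ; apply: nog; exists g; split=> //.
by move: Eind; rewrite imfset_fset1.
Qed.

End Forcing.

(** * Typesets of a bundle *)

Section Bundle.
Variables (L : language) (U : countType) (M : structure L U).
Hypotheses (hom : homogeneous M) (free : free_amalgamation_age (age M)).
Variables (n : nat) (B : bundle M n).

Local Notation F := (bsockel B).

Lemma mem_typeset j x :
  typeset M (B j) x <-> exists2 g, stabilizer M F g & g (point (B j)) = x.
Proof. by rewrite /typeset btype_sockel; split=> -[g Fg <-]; exists g. Qed.

Lemma typeset_stabilizer j g x : stabilizer M F g ->
  typeset M (B j) x -> typeset M (B j) (g x).
Proof.
move=> Fg /mem_typeset[h Fh <-]; apply/mem_typeset.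
by exists (g \o h) => //; apply: stabilizer_comp.
Qed.

Lemma typeset_notin_sockel j x : typeset M (B j) x -> x \notin F.
Proof.
move=> /mem_typeset[g [aut_g gF] <-]; apply/negP => Fgp.
have /(automorphism_inj aut_g) gp : g (g (point (B j))) = g (point (B j)) by rewrite gF.
by have := point_notin (B j); rewrite btype_sockel -{1}gp Fgp.
Qed.

(** Typesets over a common sockel are orbits of its stabilizer, so two that share a point coincide,
    against distinctness of the types. *)
Lemma typeset_inj j k x : typeset M (B j) x -> typeset M (B k) x -> j = k.
Proof.
have sub i l y : typeset M (B i) x -> typeset M (B l) x ->
    typeset M (B i) y -> typeset M (B l) y.
  move=> /mem_typeset[g Fg gp] lx /mem_typeset[h Fh <-].
  have [g' Fg' [gK _]] := stabilizer_inv Fg.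
  rewrite -(gK (point (B i))) gp.
  by do 2!apply: typeset_stabilizer => //.
move=> jx kx; apply/eqP/negPn/negP => /btype_distinct; apply; split.
  by rewrite !btype_sockel.
by apply/predeqP => y; split; apply: sub.
Qed.

Lemma bdomain_stabilizer g x : stabilizer M F g -> bdomain B x -> bdomain B (g x).
Proof.
move=> Fg [Fx|[j _ jx]]; first by left; rewrite /mkset (proj2 Fg).
by right; exists j => //; apply: typeset_stabilizer.
Qed.

(** * Finite approximations of the embedding *)

Variables (P : bool -> 'I_n -> set U).
Variables (J : {set 'I_n}) (eps' : 'I_n -> bool) (T : {fset U}).
Hypothesis FT : {subset F <= T}.
Hypothesis avoid : forall j E S h, j \in J ->
  {subset E <= S} -> indep M F E T -> stabilizer M F h ->
  h (point (B j)) \notin E -> exists g, [/\ stabilizer M E g,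
    indep M E (E `|` [fset g (h (point (B j)))]) S
    & P (eps' j) j (g (h (point (B j))))].
Hypothesis force : forall i j, j \notin J ->
  forced M F [fset point (B j)] (fun=> P i j).

(* A finite piece of the embedding under construction: the restriction of [g]
   to [D]. *)
Definition admissible (st : {fset U} * (U -> U)) : Prop :=
  let: (D, g) := st in
  [/\ {subset F <= D}, forall x, x \in D -> bdomain B x, stabilizer M F g,
      indep M F (g @` D) T
    & forall x j, x \in D -> j \in J -> typeset M (B j) x -> P (eps' j) j (g x)].

Definition extends (st st' : {fset U} * (U -> U)) : Prop :=
  {subset st.1 <= st'.1} /\ {in st.1, st'.2 =1 st.2}.

Lemma extends_refl st : extends st st.
Proof. by split. Qed.

Lemma extends_trans st1 st2 st3 :
  extends st1 st2 -> extends st2 st3 -> extends st1 st3.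
Proof.
move=> [D12 g12] [D23 g23]; split=> [x /D12/D23 //|x Dx].
by rewrite g23 ?g12 //; apply: D12.
Qed.

Lemma admissible_id : admissible (F, id).
Proof.
split=> // [x Fx||| x j Fx _ /typeset_notin_sockel]; last by rewrite Fx.
- by left.
- exact: stabilizer_id.
- rewrite imfset_id; split=> // s t Mt tF; right=> x /tF.
  by rewrite inE => /orP[/FT|].
Qed.

Lemma add_point st x : admissible st -> bdomain B x ->
  exists st', [/\ admissible st', extends st st' & x \in st'.1].
Proof.
case: st => D g st_ok dom_x; have [FD D_dom Fg indD colD] := st_ok.
have [Dx|Dx] := boolP (x \in D); first by exists (D, g); split=> //; apply: extends_refl.
case: dom_x => [/FD Dx'|[j _ jx]]; first by rewrite Dx' in Dx.
set E := g @` D in indD.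
have FE : {subset F <= E} by case: indD.
have gxE : g x \notin E.
  by rewrite mem_imfset //; apply: (automorphism_inj (proj1 Fg)).
(* The new point is placed over the current image [E], free from [T] and [E] together: by [avoid]
   with the right colour if its sort is in [J], by a free copy otherwise. *)
have [k [Ek indk colk]] : exists k, [/\ stabilizer M E k,
    indep M E (E `|` [fset k (g x)]) (E `|` T)
    & j \in J -> P (eps' j) j (k (g x))].
  have [Jj|Jj] := boolP (j \in J).
    have /mem_typeset[h Fh hx] := typeset_stabilizer Fg jx.
    rewrite -hx in gxE *.
    have [|k [? ? ?]] := @avoid j E (E `|` T) h Jj _ indD Fh gxE; last by exists k.
    by clear; fsubset_tauto.
  have [k Ek indk] := @free_copy L U M hom free E (E `|` T) (E `|` [fset g x])
    ltac:(clear; fsubset_tauto) ltac:(clear; fsubset_tauto).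
  exists k; split=> //.
  by move: indk; rewrite imfsetU imfset_fset1 (stabilizer_image Ek) => /indepC.
have kg_D : {in D, k \o g =1 g} by move=> y Dy; apply: (proj2 Ek); apply: in_imfset.
exists (D `|` [fset x], k \o g); split; last by rewrite !inE eqxx orbT.
  split.
  - by clear -FD; fsubset_tauto.
  - by move=> y; rewrite !inE => /orP[/D_dom //|/eqP->]; right; exists j.
  - by apply: stabilizer_comp => //; apply: stabilizer_sub Ek.
  - have kgD : (k \o g) @` D = E by apply: eq_in_imfset.
    by rewrite imfsetU imfset_fset1 kgD; apply: indep_trans indD indk.
  - move=> y i; rewrite !inE => /orP[Dy|/eqP->] Ji iy.
      by rewrite kg_D //; apply: colD.
    by have ij := typeset_inj iy jx; rewrite ij in Ji *; apply: colk.
by split=> //=; clear; fsubset_tauto.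
Qed.

Lemma add_points (s : seq U) st : admissible st -> {in s, forall x, bdomain B x} ->
  exists st', [/\ admissible st', extends st st' & {subset s <= st'.1}].
Proof.
elim: s st => [|x s IHs] st st_ok s_dom; first by exists st; split=> //; apply: extends_refl.
have [|st1 [st1_ok ext1 st1x]] := @add_point st x st_ok.
  by apply: s_dom; rewrite mem_head.
have [y sy|st2 [st2_ok ext2 st2s]] := IHs st1 st1_ok.
  by apply: s_dom; rewrite inE sy orbT.
exists st2; split=> // [|y]; first exact: extends_trans ext2.
by rewrite inE => /orP[/eqP->|/st2s //]; apply: (proj1 ext2).
Qed.

Lemma add_copy st (A : {fset U}) (eps : 'I_n -> bool) : admissible st ->
    (forall x, x \in A -> btypeset B x) -> {in J, eps =1 eps'} ->
  exists st' k, [/\ admissible st', extends st st', stabilizer M F k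
    & forall a, a \in A -> k a \in st'.1 /\
        forall j, typeset M (B j) a -> P (eps j) j (st'.2 (k a))].
Proof.
case: st => D g st_ok A_type epsJ.
have [FD D_dom Fg indD colD] := st_ok.
(* Making the new copy free from [D] allows its points to be placed without regard to [g]. *)
have [k Fk indk] := @free_copy L U M hom free F D (F `|` A)
  ltac:(clear -FD; fsubset_tauto) ltac:(clear; fsubset_tauto).
rewrite imfsetU (stabilizer_image Fk) in indk.
pose A' := k @` A.
have A'_type x : x \in A' -> btypeset B x.
  by move=> /imfsetP[a /A_type[j _ ja] ->]; exists j => //; apply: typeset_stabilizer.
pose A0 := [fset x in A' | `[< exists2 j, j \notin J & typeset M (B j) x >]].
have A0A' : {subset A0 <= A'} by move=> x; rewrite !inE => /andP[].
pose Q x : set U := [set y | forall j, typeset M (B j) x -> P (eps j) j y]%classic.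
(* Freeness from the image of [D] permits gluing [h] with [g]; freeness from [T] keeps the result
   admissible. *)
have [h [Fh indh Qh]] : exists h, [/\ stabilizer M F h,
    indep M F (F `|` h @` A0) (g @` D `|` T)
    & forall a, a \in A0 -> Q a (h a)].
  apply: (forced_realized hom free); last by move=> x /FT; rewrite inE orbC => ->.
  apply: forced_points => // a; rewrite !inE => /andP[_ /asboolP[j Jj ja]].
  have /mem_typeset[h Fh ha] := ja; rewrite -ha.
  apply: eq_forced (forced_orbit Fh (force (eps j) Jj)) => _ y /fset1P-> Py i.
  by rewrite ha => ia; rewrite (typeset_inj ia ja).
have indDA0 : indep M F D (F `|` A0).
  by apply: indep_sub indk; clear -FD A0A'; fsubset_tauto.
have [r [aut_r rD rA0]] : exists r, [/\ automorphism M r,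
    {in D, r =1 g} & {in F `|` A0, r =1 h}].
  apply: (glue hom (Z := F)) => //; [by case: Fg | by case: Fh | |].
    by move=> x Fx; rewrite (proj2 Fg) ?(proj2 Fh).
  rewrite (stabilizer_image Fg) imfsetU (stabilizer_image Fh); apply/indepC.
  by apply: indep_sub indh; case: indD => FgD _ _ _; clear -FgD; fsubset_tauto.
have Fr : stabilizer M F r.
  by split=> // x Fx; rewrite rD ?(proj2 Fg) //; apply: FD.
have st1_ok : admissible (D `|` A0, r).
  split=> //.
  - by clear -FD; fsubset_tauto.
  - by move=> x; rewrite inE => /orP[/D_dom //|/A0A'/A'_type]; right.
  - have rgD : r @` D = g @` D by apply: eq_in_imfset.
    rewrite imfsetU rgD; have -> : r @` A0 = h @` A0.
      by apply: eq_in_imfset => x A0x; apply: rA0; rewrite inE A0x orbT.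
    have {}indh : indep M (g @` D) (g @` D `|` (F `|` h @` A0)) (g @` D `|` T).
      by apply: indep_base indh; case: indD => FgD _ _ _; clear -FgD; fsubset_tauto.
    apply: indep_sub (indep_trans indD indh); case: indD => FgD FT' _ _;
      clear -FgD FT'; fsubset_tauto.
  - move=> x j; rewrite inE => /orP[Dx|A0x] Jj jx; first by rewrite rD //; apply: colD.
    move: A0x; rewrite !inE => /andP[_ /asboolP[i Ji ix]].
    by rewrite (typeset_inj ix jx) Jj in Ji.
(* The remaining points of the copy have sorts in [J]; admissibility gives them the colour [eps'],
   which is [eps] there. *)
have [|st2 [st2_ok ext2 st2A']] := @add_points (enum_fset A') _ st1_ok.
  by move=> x A'x; right; apply: A'_type.
have ext1 : extends (D, g) (D `|` A0, r) by split=> //=; clear; fsubset_tauto.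
exists st2, k; split=> //; first exact: extends_trans ext2.
move=> a Aa; have A'ka : k a \in A' by apply: in_imfset.
have st2ka := st2A' _ A'ka; split=> // j ja.
have jka := typeset_stabilizer Fk ja.
have [Jj|Jj] := boolP (j \in J).
  rewrite epsJ //; case: st2 st2_ok st2ka {ext2 st2A'} => D2 g2 [_ _ _ _ col2] D2ka.
  exact: col2.
have A0ka : k a \in A0 by rewrite !inE A'ka; apply/asboolP; exists j.
rewrite (proj2 ext2) /= ?rA0; try by rewrite inE A0ka orbT.
exact: Qh.
Qed.

Lemma weakly_indivisible_of_forced : exists C : set U,
  [/\ bcopy B C,
      forall j, j \in J -> (C `&` typeset M (B j) `<=` P (eps' j) j)%classic
    & forall eps : 'I_n -> bool, (forall j, j \in J -> eps j = eps' j) ->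
        rhobar B ((\bigcup_(j in [set: 'I_n]) P (eps j) j) `&` C)%classic
        = rhobar B (btypeset B)].
Proof.
(* A task is either a point to be put in the domain or a set [A] to be copied with colours [eps].
   Indices that code no task, and tasks whose premises fail, leave the state unchanged. *)
pose task : countType := (U + {fset U} * {ffun 'I_n -> bool})%type.
pose done_with (m : nat) (st : {fset U} * (U -> U)) :=
  match @choice.unpickle task m with
  | Some (inl x) => bdomain B x -> x \in st.1
  | Some (inr (A, eps)) =>
      (forall x, x \in A -> btypeset B x) -> {in J, eps =1 eps'} ->
      exists2 k, stabilizer M F k & forall a, a \in A -> k a \in st.1 /\
        forall j, typeset M (B j) a -> P (eps j) j (st.2 (k a))
  | None => True
  end.
have [|s sP] := @increasing_chain {st | admissible st}
    (fun st st' => extends (sval st) (sval st'))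
    (fun m st => done_with m (sval st)) (exist _ _ admissible_id).
  move=> [st st_ok] m; rewrite /done_with.
  have stay (X : Prop) : X -> exists st' : {st | admissible st},
      extends st (sval st') /\ X.
    by exists (exist _ st st_ok); split=> //; apply: extends_refl.
  case: (@choice.unpickle task m) => [[x|[A eps]]|]; last exact: stay.
  - have [dom_x|ndom_x] := pselect (bdomain B x); last first.
      by exists (exist _ st st_ok); split=> //; apply: extends_refl.
    have [st' [st'_ok ext st'x]] := add_point st_ok dom_x.
    by exists (exist _ st' st'_ok).
  - have [A_type|nA] := pselect (forall x, x \in A -> btypeset B x); last first.
      by exists (exist _ st st_ok); split=> //; apply: extends_refl.
    have [epsJ|neps] := pselect {in J, eps =1 eps'}; last first.
      by exists (exist _ st st_ok); split=> //; apply: extends_refl.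
    have [st' [k [st'_ok ext Fk kA]]] := add_copy st_ok A_type epsJ.
    by exists (exist _ st' st'_ok); split=> //; exists k.
pose D m := (sval (s m)).1; pose g m := (sval (s m)).2.
have ext m m' : (m <= m')%N -> extends (sval (s m)) (sval (s m')).
  move/subnKC <-; elim: (m' - m)%N => [|d IHd]; first by rewrite addn0; apply: extends_refl.
  by rewrite addnS; apply: extends_trans IHd (proj1 (sP _)).
have ok m : admissible (D m, g m).
  by rewrite /D /g -surjective_pairing; apply: (svalP (s m)).
(* The value at [x] is read at the stage just after the task of [x]; any other stage whose domain
   contains [x] agrees. *)
pose f x := g (choice.pickle (inl x : task)).+1 x.
have D_f x : bdomain B x -> x \in D (choice.pickle (inl x : task)).+1.
  by have := proj2 (sP (choice.pickle (inl x : task))); rewrite /done_with choice.pickleK; apply.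
have g_eq m m' x : x \in D m -> x \in D m' -> g m x = g m' x.
  move=> Dmx Dm'x; have [/ext|/ltnW/ext] := leqP m m'; case=> _ e.
    by rewrite /g e.
  by rewrite /g e.
have fE m x : bdomain B x -> x \in D m -> f x = g m x.
  by move=> /D_f Dx Dmx; apply: g_eq.
have F_g m : stabilizer M F (g m) by case: (ok m).
have D_seq (r : seq U) : {in r, forall x, bdomain B x} -> exists m, {subset r <= D m}.
  elim: r => [|x r IHr] r_dom; first by exists 0.
  have [y ry|m rm] := IHr; first by apply: r_dom; rewrite inE ry orbT.
  exists (maxn m (choice.pickle (inl x : task)).+1) => y.
  rewrite inE => /orP[/eqP->|/rm Dmy].
    apply: (proj1 (ext _ _ (leq_maxr _ _))); apply: D_f.
    by apply: r_dom; rewrite mem_head.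
  by apply: (proj1 (ext _ _ (leq_maxl _ _))).
have f_type j x : typeset M (B j) x -> typeset M (B j) (f x).
  exact: (typeset_stabilizer (F_g _)).
exists (f @` bdomain B)%classic; split.
- exists f => //; split=> [x|A A_dom]; first exact: (bdomain_stabilizer (F_g _)).
  have [|m Am] := D_seq (enum_fset A); first by move=> x; apply: A_dom.
  exists (g m) => // x Ax; apply: fE; [exact: A_dom | exact: Am].
- move=> j Jj y [[x dom_x <-] jfx].
  have jx : typeset M (B j) x.
    case: dom_x => [Fx|[i _ ix]]; last by rewrite -(typeset_inj (f_type i x ix) jfx).
    by move: jfx; rewrite /f (proj2 (F_g _)) // => /typeset_notin_sockel; rewrite Fx.
  by case: (ok (choice.pickle (inl x : task)).+1) => _ _ _ _; apply=> //; apply: D_f.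
move=> eps epsJ; apply/seteqP; split=> A [A_type _]; split=> //.
  exists id; first exact: stabilizer_id.
  by move=> _ [x Ax <-]; apply: A_type.
(* The task of the pair [A], [eps] has put a suitable copy of [A] into the domain at stage
   [m.+1]. *)
pose m := choice.pickle (inr (A, [ffun j => eps j]) : task).
have := proj2 (sP m); rewrite /done_with choice.pickleK.
case=> [x Ax|j Jj|k Fk kA]; [exact: A_type | by rewrite ffunE epsJ |].
exists (g m.+1 \o k); first exact: stabilizer_comp.
move=> _ [a Aa <-] /=; have [Dka Pka] := kA a Aa.
have [j _ ja] := A_type a Aa; split.
  by exists j => //; have := Pka j ja; rewrite ffunE.
exists (k a); last apply: fE => //.
all: by right; exists j => //; apply: typeset_stabilizer.
Qed.

End Bundle.

Theorem theorem9p1 (L : language) (U : countType) (M : structure L U)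
  (hom : homogeneous M) (free : free_amalgamation_age (age M))
  (n : nat) (B : bundle M n) : weakly_indivisible B.
Proof.
move=> P P_part; pose F := bsockel B.
pose freq i j := forced M F [fset point (B j)] (fun=> P i j).
pose J := [set j | ~~ `[< forall i, freq i j >]].
(* For [j] in [J], the opposite colour [~~ eps' j] is not frequent. *)
pose eps' j := ~~ `[< freq false j >].
have avoidable (j : 'I_n) : exists T : {fset U}, j \in J ->
    {subset F <= T} /\
    forall E S h, {subset E <= S} -> indep M F E T -> stabilizer M F h ->
      h (point (B j)) \notin E -> exists g, [/\ stabilizer M E g,
        indep M E (E `|` [fset g (h (point (B j)))]) S
        & P (eps' j) j (g (h (point (B j))))].
  have [Jj|_] := boolP (j \in J); last by exists fset0.
  have : ~ freq (~~ eps' j) j.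
    move: Jj; rewrite inE /eps' negbK => /asboolP nall.
    by case: asboolP => // ffalse ftrue; apply: nall; case.
  move=> nfreq; have [T FT avoidT] := not_forced nfreq; exists T => _; split=> // E S h ES ET Fh hE.
  have [g [Eg gind nP]] := avoidT E S h ES ET Fh hE; exists g; split=> //.
  (* The point stays in the typeset, so missing one block of the partition puts it in the other. *)
  have : typeset M (B j) (g (h (point (B j)))).
    apply/mem_typeset; exists (g \o h) => //; apply: stabilizer_comp => //.
    by apply: stabilizer_sub Eg; case: ET.
  by have [<- _] := P_part j; case; case: (eps' j) nP.
have [T_ T_P] := choice avoidable.
(* Independence from this union implies independence from each witness [T_ j] with [j] in [J]. *)
pose T := F `|` \bigcup_(j in J) T_ j.
have FT : {subset F <= T} by move=> x Fx; rewrite inE Fx.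
have [j E S h Jj ES ET|i j|C [C_copy C_J C_rho]] :=
    @weakly_indivisible_of_forced L U M hom free n B P J eps' T FT.
- have [FTj avoidTj] := T_P j Jj; have [FE _ _ _] := ET.
  apply: avoidTj => //; apply: indep_sub ET => //.
  move=> x Tjx; rewrite inE; apply/orP; right; apply/bigfcupP.
  by exists j; rewrite ?mem_index_enum ?Jj.
- by rewrite inE negbK => /asboolP; apply.
by exists J, eps', C.
Qed.
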